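(* Let $n$ be a fixed odd number. For any $f\in\mathcal{F}(\mathbb{R}^{n+1})$ and $x\in\mathbb{R}^{n+1}$ we have $$|f(x)|\le 2^{\frac n2}e^{\frac{|x|^2}{2}}\|f\|_{\mathcal{F}(\mathbb{R}^{n+1})}.$$ Moreover, the reproducing kernel of the Clifford-Appell-Fock space $\mathcal{F}(\mathbb{R}^{n+1})$ is given by the convergent series $$K_{\mathcal{F}}(x,y)=\sum_{k=0}^\infty\frac{P_k^n(x)\overline{P_k^n(y)}}{k!},\qquad x,y\in\mathbb{R}^{n+1}.$$
   Context: $\mathbb{R}_n$ is the real Clifford algebra generated by $e_1,\dots,e_n$ with $e_\ell e_m+e_me_\ell=0$ for $\ell\ne m$ and $e_\ell^2=-1$; for $a=\sum_A a_Ae_A$, $|a|=(\sum_A a_A^2)^{1/2}$; $a\mapsto\bar a$ is Clifford conjugation (the anti-automorphism with $\overline{e_\ell}=-e_\ell$) and $\mathrm{Re}(a)$ is the scalar part. A point $(x_0,\dots,x_n)\in\mathbb{R}^{n+1}$ is identified with the paravector $x=x_0+\underline{x}$, $\underline{x}=\sum_{\ell=1}^n x_\ell e_\ell$; $\bar x=x_0-\underline{x}$. The Clifford-Appell polynomials are $$P_k^n(x):=\sum_{s=0}^k T_s^k(n)\,x^{k-s}\bar x^{s},\qquad T_s^k(n):=\binom{k}{s}\frac{\left(\frac{n+1}{2}\right)_{k-s}\left(\frac{n-1}{2}\right)_s}{(n)_k},$$ where $(a)_0=1$ and $(a)_s=a(a+1)\cdots(a+s-1)$ for $s>0$. The Clifford-Appell-Fock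 space is $\mathcal{F}(\mathbb{R}^{n+1}):=\{\sum_{k=0}^\infty P_k^n(x)\alpha_k:\alpha_k\in\mathbb{R}_n,\ \sum_k k!|\alpha_k|^2<\infty\}$, with inner product $\langle\sum P_k^n\alpha_k,\sum P_k^n\beta_k\rangle_{\mathcal{F}(\mathbb{R}^{n+1})}=\sum_k k!\,\overline{\alpha_k}\beta_k$ and norm $\|f\|=\sqrt{\mathrm{Re}\langle f,f\rangle}$. Reproducing kernel means: $K_{\mathcal{F}}(\cdot,y)\in\mathcal{F}(\mathbb{R}^{n+1})$ and $\langle K_{\mathcal{F}}(\cdot,y),f\rangle_{\mathcal{F}(\mathbb{R}^{n+1})}=f(y)$ for all $f\in\mathcal{F}(\mathbb{R}^{n+1})$, $y\in\mathbb{R}^{n+1}$. *)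

(* Defs.v *)
From HB Require Import structures.
From mathcomp Require Import all_boot all_order all_algebra.
From mathcomp Require Import ring.
From mathcomp Require Import all_classical all_reals all_analysis.
Set Implicit Arguments.
Unset Strict Implicit.
Unset Printing Implicit Defensive.
Import Order.TTheory GRing.Theory Num.Theory.
Import numFieldNormedType.Exports.
Local Open Scope classical_set_scope.
Local Open Scope ring_scope.

Local Notation fset0 := (@finset.set0 _).

Section SymmetricDifference.
Context {n : nat}.
Implicit Types A B C : {set 'I_n}.

Definition symd A B : {set 'I_n} := [set i | (i \in A) (+) (i \in B)]%SET.

Lemma symdA : associative symd.
Proof. by move=> A B C; apply/finset.setP => i; rewrite !finset.inE addbA. Qed.

Lemma symdC : commutative symd.
Proof. by move=> A B; apply/finset.setP => i; rewrite !finset.inE addbC. Qed.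

Lemma symd0 : right_id fset0 symd.
Proof. by move=> A; apply/finset.setP => i; rewrite !finset.inE addbF. Qed.

Lemma sym0d : left_id fset0 symd.
Proof. by move=> A; rewrite symdC symd0. Qed.

Lemma symdd A : symd A A = fset0.
Proof. by apply/finset.setP => i; rewrite !finset.inE addbb. Qed.

Lemma symdK A : involutive (symd A).
Proof. by move=> B; rewrite symdA symdd sym0d. Qed.

Lemma symdKr A B : symd (symd A B) B = A.
Proof. by rewrite -symdA symdd symd0. Qed.

End SymmetricDifference.

(* For A = {i_1 < ... < i_p} write e_A = e_{i_1} ... e_{i_p}.  Then
   e_A e_B = csgn A B * e_{symd A B}: a factor -1 is produced by each
   transposition of some e_i (i in A) with some e_j (j in B, j < i), and by
   each contraction e_i e_i = -1 (i in A and B). *)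
Definition csgn (R : pzRingType) n (A B : {set 'I_n}) : R :=
  \prod_(i in A) \prod_(j in B | (j <= i)%N) (-1).

Section Csgn.
Context {R : comPzRingType} {n : nat}.
Implicit Types A B C : {set 'I_n}.

Local Lemma prod_symd (F : 'I_n -> R) A B : (forall i, F i * F i = 1) ->
  \prod_(i in symd A B) F i = (\prod_(i in A) F i) * \prod_(i in B) F i.
Proof.
move=> F2; rewrite big_mkcond [X in _ = X * _]big_mkcond [X in _ = _ * X]big_mkcond.
rewrite -big_split /=.
by apply: eq_bigr => i _; rewrite finset.inE; case: (i \in A); case: (i \in B);
  rewrite /= ?mulr1 ?mul1r ?F2.
Qed.

Local Lemma prodN1_sqr (I : finType) (P : pred I) :
  (\prod_(i | P i) (-1) : R) * \prod_(i | P i) (-1) = 1.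
Proof. by rewrite -big_split /= big1 // => i _; rewrite mulrNN mulr1. Qed.

Lemma csgn_sqr A B : csgn R A B * csgn R A B = 1.
Proof.
by rewrite -big_split /= big1 // => i _; apply: prodN1_sqr.
Qed.

Lemma csgnDl A B C : csgn R (symd A B) C = csgn R A C * csgn R B C.
Proof. by apply: prod_symd => i; apply: prodN1_sqr. Qed.

Lemma csgnDr A B C : csgn R A (symd B C) = csgn R A B * csgn R A C.
Proof.
rewrite /csgn -big_split /=; apply: eq_bigr => i _.
rewrite !big_mkcondr prod_symd // => j.
by case: ifP; rewrite ?mulrNN mulr1.
Qed.

Lemma csgn0l A : csgn R fset0 A = 1.
Proof. by rewrite /csgn finset.big_set0. Qed.

Lemma csgn0r A : csgn R A fset0 = 1.
Proof. by rewrite /csgn big1 // => i _; rewrite big1 // => j; rewrite finset.inE. Qed.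

End Csgn.

(* The real Clifford algebra with n generators of square -1, as the space of
   coordinate families (a_A) in the basis (e_A). The alias keeps it apart from
   the pointwise ring structure of {ffun _ -> R}. *)
Definition clifford (R : realType) (n : nat) := {ffun {set 'I_n} -> R}.

HB.instance Definition _ (R : realType) n :=
  GRing.Lmodule.copy (clifford R n) {ffun {set 'I_n} -> R}.

Section CliffordRing.
Context {R : realType} {n : nat}.
Local Notation Cl := (clifford R n).
Implicit Types (a b c : Cl) (A B C : {set 'I_n}).

Definition cbasis A : Cl := [ffun B => (B == A)%:R].

(* The coordinate of a * b at C is the sum over the pairs (A, B) with
   symd A B = C, i.e. B = symd A C. *)
Definition cmul a b : Cl :=
  [ffun C => \sum_A csgn R A (symd A C) * (a A * b (symd A C))].

Lemma clifford_addE a b A : (a + b) A = a A + b A.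
Proof. exact: ffunE. Qed.

Lemma clifford_scaleE (t : R) a A : (t *: a) A = t * a A.
Proof. exact: ffunE. Qed.

Lemma clifford_sumE (I : Type) (r : seq I) (P : pred I) (F : I -> Cl) A :
  (\sum_(i <- r | P i) F i) A = \sum_(i <- r | P i) F i A.
Proof.
by elim/big_rec2: _ => [|i y x _ <-]; rewrite ?ffunE.
Qed.

Lemma clifford_sum_cbasis a : a = \sum_A a A *: cbasis A.
Proof.
apply/ffunP => B; rewrite clifford_sumE (bigD1 B) //= big1 => [|A AB].
  by rewrite clifford_scaleE ffunE eqxx mulr1 addr0.
by rewrite clifford_scaleE ffunE eq_sym (negPf AB) mulr0.
Qed.

Local Lemma cmulA : associative cmul.
Proof.
move=> a b c; apply/ffunP => D; rewrite !ffunE.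
transitivity (\sum_A \sum_B csgn R A (symd A D) *
   (a A * (csgn R B (symd B (symd A D)) * (b B * c (symd B (symd A D)))))).
  apply: eq_bigr => A _; rewrite ffunE !big_distrr /=.
  by apply: eq_bigr.
symmetry; transitivity (\sum_E \sum_A csgn R E (symd E D) *
   (csgn R A (symd A E) * (a A * b (symd A E)) * c (symd E D))).
  apply: eq_bigr => E _; rewrite ffunE big_distrl big_distrr /=.
  by apply: eq_bigr.
rewrite exchange_big /=; apply: eq_bigr => A _.
rewrite (reindex_inj (inv_inj (symdK A))) /=; apply: eq_bigr => B _.
rewrite symdK.
have -> : symd (symd A B) D = symd B (symd A D) by rewrite symdA (symdC A B).
have eD : symd A D = symd B (symd B (symd A D)) by rewrite symdK.
rewrite [in csgn R A (symd A D)]eD; move: (symd B (symd A D)) => C.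
rewrite csgnDl csgnDr; set u := csgn R A C; set v := csgn R B C.
transitivity (csgn R A B * u * v * a A * b B * c C).
  by ring.
by ring.
Qed.

Local Lemma cmul1 : left_id (cbasis fset0) cmul.
Proof.
move=> a; apply/ffunP => C; rewrite ffunE (bigD1 fset0) //= big1 => [|A A0].
  by rewrite csgn0l sym0d ffunE eqxx !mul1r addr0.
by rewrite ffunE (negPf A0) mul0r mulr0.
Qed.

Local Lemma cmulr1 : right_id (cbasis fset0) cmul.
Proof.
move=> a; apply/ffunP => C; rewrite ffunE (bigD1 C) //= big1 => [|A AC].
  by rewrite symdd csgn0r ffunE eqxx mulr1 mul1r addr0.
rewrite ffunE; case: eqP => [e|]; last by rewrite !mulr0.
by case/eqP: AC; rewrite -[RHS](symdK A) e symd0.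
Qed.

Local Lemma cmulDl : left_distributive cmul +%R.
Proof.
move=> a b c; apply/ffunP => C; rewrite clifford_addE !ffunE -big_split.
by apply: eq_bigr => A _; rewrite /= clifford_addE mulrDl mulrDr.
Qed.

Local Lemma cmulDr : right_distributive cmul +%R.
Proof.
move=> a b c; apply/ffunP => C; rewrite clifford_addE !ffunE -big_split.
by apply: eq_bigr => A _; rewrite /= clifford_addE !mulrDr.
Qed.

Local Lemma cone_neq0 : cbasis fset0 != 0.
Proof.
apply/eqP => /ffunP/(_ fset0); rewrite !ffunE eqxx => /eqP.
by rewrite oner_eq0.
Qed.

HB.instance Definition _ := GRing.Zmodule_isNzRing.Build Cl
  cmulA cmul1 cmulr1 cmulDl cmulDr cone_neq0.

Local Lemma cscalerAl (t : R) a b : t *: (a * b) = (t *: a) * b.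
Proof.
apply/ffunP => C; rewrite clifford_scaleE !ffunE big_distrr /=.
by apply: eq_bigr => A _; rewrite clifford_scaleE mulrCA !mulrA.
Qed.

HB.instance Definition _ := GRing.Lmodule_isLalgebra.Build R Cl cscalerAl.

Local Lemma cscalerAr (t : R) a b : t *: (a * b) = a * (t *: b).
Proof.
apply/ffunP => C; rewrite clifford_scaleE !ffunE big_distrr /=.
apply: eq_bigr => A _; rewrite clifford_scaleE mulrCA; congr (_ * _).
by rewrite mulrCA.
Qed.

HB.instance Definition _ := GRing.Lalgebra_isAlgebra.Build R Cl cscalerAr.

Lemma clifford_mulE a b C :
  (a * b) C = \sum_A csgn R A (symd A C) * (a A * b (symd A C)).
Proof. exact: ffunE. Qed.

Lemma cbasis0 : cbasis fset0 = 1.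
Proof. by []. Qed.

Lemma cbasisM A B : cbasis A * cbasis B = csgn R A B *: cbasis (symd A B).
Proof.
apply/ffunP => C; rewrite clifford_mulE clifford_scaleE (bigD1 A) //=.
rewrite big1 => [|D DA]; last by rewrite ffunE (negPf DA) mul0r mulr0.
rewrite !ffunE eqxx mul1r addr0.
have -> : (symd A C == B) = (C == symd A B).
  by apply/eqP/eqP => [<-|->]; rewrite symdK.
by case: eqP => [->|]; rewrite ?symdK ?mulr0.
Qed.

Definition cgen (l : 'I_n) : Cl := cbasis [set l]%SET.

Lemma cgen_sqr l : cgen l * cgen l = -1.
Proof.
rewrite cbasisM symdd /csgn finset.big_set1 (big_pred1 l) => [|j].
  by rewrite cbasis0 scaleN1r.
by rewrite finset.inE /=; case: eqP => // ->; rewrite leqnn.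
Qed.

Lemma cgen_anticomm l m : l != m -> cgen l * cgen m + cgen m * cgen l = 0.
Proof.
move=> lm; rewrite !cbasisM (symdC [set m]%SET) -scalerDl /csgn !finset.big_set1 !big_mkcondr.
rewrite !finset.big_set1.
case: (ltngtP l m) => [_|_|/val_inj e]; last by rewrite e eqxx in lm.
- by rewrite subrr scale0r.
- by rewrite addrC subrr scale0r.
Qed.

Lemma cbasis_prod A : cbasis A = \prod_(i <- enum A) cgen i.
Proof.
have cbasis_seq (s : seq 'I_n) : sorted (fun i j : 'I_n => (i < j)%N) s ->
    \prod_(i <- s) cgen i = cbasis [set i in s]%SET.
  elim: s => [_|i s IHs /= ps].
    by rewrite big_nil; congr cbasis; apply/finset.setP => i; rewrite !finset.inE.
  have lts : all (fun j : 'I_n => (i < j)%N) s.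
    by apply: order_path_min ps => ? ? ?; apply: ltn_trans.
  rewrite big_cons IHs ?(path_sorted ps) // cbasisM /csgn finset.big_set1.
  rewrite big1 => [|j /andP[]].
    rewrite scale1r; congr cbasis; apply/finset.setP => j; rewrite !finset.inE.
    by have [->|//] := eqVneq j i; rewrite /=; have [/(allP lts)|//] := boolP (i \in s); rewrite ltnn.
  by rewrite finset.inE => /(allP lts) ij; rewrite leqNgt ij.
rewrite cbasis_seq; last first.
  rewrite /enum_mem; apply: sorted_filter; first by move=> ? ? ?; apply: ltn_trans.
  by have := iota_ltn_sorted 0 n; rewrite -val_enum_ord sorted_map enumT.
by congr cbasis; apply/finset.setP => i; rewrite finset.inE mem_enum.
Qed.

Definition cre a : R := a fset0.

(* The sign csgn A A is (-1) ^ (p (p + 1) / 2) for p = #|A|; see cconj_gen and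
   cconjM. *)
Definition cconj a : Cl := [ffun A => csgn R A A * a A].

Lemma cconjD a b : cconj (a + b) = cconj a + cconj b.
Proof. by apply/ffunP => A; rewrite !ffunE mulrDr. Qed.

Lemma cconjZ (t : R) a : cconj (t *: a) = t *: cconj a.
Proof. by apply/ffunP => A; rewrite !ffunE mulrCA. Qed.

Lemma cconj_basis A : cconj (cbasis A) = csgn R A A *: cbasis A.
Proof.
apply/ffunP => B; rewrite clifford_scaleE !ffunE.
by case: eqP => [->|]; rewrite ?mulr0.
Qed.

Lemma cconj1 : cconj 1 = 1.
Proof. by rewrite -cbasis0 cconj_basis csgn0l scale1r. Qed.

Lemma cconj_gen l : cconj (cgen l) = - cgen l.
Proof.
rewrite cconj_basis /csgn finset.big_set1 (big_pred1 l) ?scaleN1r // => j.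
by rewrite finset.inE /=; case: eqP => // ->; rewrite leqnn.
Qed.

Lemma cconjM a b : cconj (a * b) = cconj b * cconj a.
Proof.
apply/ffunP => C; rewrite ffunE !clifford_mulE big_distrr /=.
have injC : injective (fun A => symd A C).
  exact: (@can_inj _ _ _ (fun A => symd A C) (symdKr ^~ C)).
rewrite [RHS](reindex_inj injC) /=.
apply: eq_bigr => A _; rewrite !ffunE symdKr.
have -> : csgn R C C = csgn R (symd A (symd A C)) (symd A (symd A C)).
  by rewrite symdK.
move: (symd A C) => D; rewrite csgnDl !csgnDr.
have := csgn_sqr (R := R) A D.
set u := csgn R A D => uu.
transitivity (csgn R A A * csgn R D A * csgn R D D * (u * u) * a A * b D).
  by ring.
by rewrite uu; ring.
Qed.

Lemma cre_conjM a : cre (cconj a * a) = \sum_A a A ^+ 2.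
Proof.
rewrite /cre clifford_mulE; apply: eq_bigr => A _.
by rewrite symd0 ffunE !mulrA csgn_sqr mul1r expr2.
Qed.

Definition cnorm a : R := Num.sqrt (\sum_A a A ^+ 2).

Local Lemma sumsq_ge0 a : 0 <= \sum_A a A ^+ 2.
Proof. by apply: sumr_ge0 => A _; apply: sqr_ge0. Qed.

Local Lemma cnorm_sqr a : cnorm a ^+ 2 = \sum_A a A ^+ 2.
Proof. by rewrite sqr_sqrtr ?sumsq_ge0. Qed.

Local Lemma cnorm_eq0 a : cnorm a = 0 -> a = 0.
Proof.
move=> a0; have := cnorm_sqr a; rewrite a0 expr0n /= => /esym/eqP.
rewrite psumr_eq0 => [/allP a_eq0|A _]; last exact: sqr_ge0.
apply/ffunP => A; rewrite [RHS]ffunE; apply/eqP; rewrite -sqrf_eq0.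
exact: a_eq0 (mem_index_enum A).
Qed.

Local Lemma cnorm0 : cnorm 0 = 0.
Proof. by rewrite /cnorm big1 ?sqrtr0 // => A _; rewrite ffunE expr0n. Qed.

Local Lemma cnormZ (t : R) a : cnorm (t *: a) = `|t| * cnorm a.
Proof.
rewrite -sqrtr_sqr -sqrtrM ?sqr_ge0 // mulr_sumr; congr (Num.sqrt _).
by apply: eq_bigr => A _; rewrite clifford_scaleE exprMn.
Qed.

Local Lemma cauchy_schwarz a b : \sum_A a A * b A <= cnorm a * cnorm b.
Proof.
have [/cnorm_eq0->|a0] := eqVneq (cnorm a) 0.
  by rewrite cnorm0 mul0r big1 // => A _; rewrite ffunE mul0r.
have [/cnorm_eq0->|b0] := eqVneq (cnorm b) 0.
  by rewrite cnorm0 mulr0 big1 // => A _; rewrite ffunE mulr0.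
have ab_gt0 : 0 < cnorm a * cnorm b.
  by rewrite mulr_gt0 // lt0r ?a0 ?b0 sqrtr_ge0.
have : 0 <= \sum_A (cnorm b * a A - cnorm a * b A) ^+ 2.
  by apply: sumr_ge0 => A _; apply: sqr_ge0.
have -> : \sum_A (cnorm b * a A - cnorm a * b A) ^+ 2 =
    cnorm b ^+ 2 * (\sum_A a A ^+ 2) + cnorm a ^+ 2 * (\sum_A b A ^+ 2) -
    2 * (cnorm a * cnorm b) * \sum_A a A * b A.
  by rewrite !mulr_sumr -big_split -sumrB /=; apply: eq_bigr => A _; ring.
rewrite -!cnorm_sqr.
set x := cnorm a; set y := cnorm b; set s := \sum_A _.
have -> : y ^+ 2 * x ^+ 2 + x ^+ 2 * y ^+ 2 - 2 * (x * y) * s =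
  2 * (x * y) * (x * y - s) by ring.
by rewrite pmulr_rge0 ?subr_ge0 // mulr_gt0.
Qed.

Local Lemma cnormD a b : cnorm (a + b) <= cnorm a + cnorm b.
Proof.
rewrite -(@ler_pXn2r _ 2) ?nnegrE ?addr_ge0 ?sqrtr_ge0 //.
rewrite cnorm_sqr sqrrD !cnorm_sqr.
have -> : \sum_A (a + b) A ^+ 2 =
    \sum_A a A ^+ 2 + (\sum_A a A * b A) *+ 2 + \sum_A b A ^+ 2.
  rewrite -sumrMnl -!big_split /=.
  by apply: eq_bigr => A _; rewrite clifford_addE sqrrD.
by rewrite lerD2r lerD2l lerMn2r cauchy_schwarz.
Qed.

HB.instance Definition _ :=
  Lmodule_isNormed.Build R Cl cnormD cnormZ cnorm_eq0.

Lemma clifford_normE a : `|a| = Num.sqrt (\sum_A a A ^+ 2).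
Proof. by []. Qed.

End CliffordRing.

Definition paravector (R : realType) n (x : 'rV[R]_n.+1) : clifford R n :=
  (x 0 0)%:A + \sum_(l < n) x 0 (lift ord0 l) *: cgen l.

Lemma cconj_paravector (R : realType) n (x : 'rV[R]_n.+1) :
  cconj (paravector x) =
  (x 0 0)%:A - \sum_(l < n) x 0 (lift ord0 l) *: cgen l.
Proof.
rewrite cconjD cconjZ cconj1; congr (_ + _); rewrite -sumrN.
elim/big_rec2: _ => [|l u v _ <-]; last by rewrite cconjD cconjZ cconj_gen scalerN.
by rewrite -[0 in LHS](scale0r 1) cconjZ scale0r.
Qed.

(* The norm of 'rV[R]_n.+1 in the library is the sup norm; the Euclidean norm
   |x| is the Clifford norm of the paravector x. *)
Lemma norm_paravector (R : realType) n (x : 'rV[R]_n.+1) :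
  `|paravector x| = Num.sqrt (\sum_(i < n.+1) x 0 i ^+ 2).
Proof.
pose S (i : 'I_n.+1) : {set 'I_n} :=
  if unlift ord0 i is Some l then [set l]%SET else fset0.
have SE i j : (S i == S j) = (j == i).
  rewrite /S; case: unliftP => [k|] ->; case: unliftP => [l|] ->.
  - by rewrite (inj_eq finset.set1_inj) (inj_eq lift_inj) eq_sym.
  - by rewrite -finset.cards_eq0 finset.cards1.
  - by rewrite eq_sym -finset.cards_eq0 finset.cards1.
  - by rewrite !eqxx.
have pE A : paravector x A = \sum_i x 0 i * (A == S i)%:R.
  rewrite big_ord_recl clifford_addE clifford_scaleE clifford_sumE.
  rewrite /S unlift_none -cbasis0 ffunE; congr (_ + _); apply: eq_bigr => l _.
  by rewrite liftK clifford_scaleE ffunE.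
rewrite clifford_normE; congr (Num.sqrt _).
under eq_bigr => A _ do rewrite expr2 {1}pE mulr_suml.
rewrite exchange_big /=; apply: eq_bigr => i _.
rewrite (bigD1 (S i)) //= eqxx mulr1 big1 ?addr0 => [|A /negPf->]; last first.
  by rewrite mulr0 mul0r.
rewrite pE (bigD1 i) //= eqxx mulr1 big1 ?addr0 // => j /negPf ji.
by rewrite SE ji mulr0.
Qed.

Definition pochhammer (R : pzSemiRingType) (a : R) (s : nat) : R :=
  \prod_(i < s) (a + i%:R).

Definition appell_coef (R : realType) (n k s : nat) : R :=
  'C(k, s)%:R *
  (pochhammer ((n%:R + 1) / 2) (k - s) * pochhammer ((n%:R - 1) / 2) s) /
  pochhammer n%:R k.

Definition appell (R : realType) n (k : nat) (x : 'rV[R]_n.+1) :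
    clifford R n :=
  \sum_(s < k.+1) appell_coef R n k s *:
    (paravector x ^+ (k - s) * cconj (paravector x) ^+ s).

Section Fock.
Context {R : realType} {n : nat}.
Local Notation Cl := (clifford R n).
Implicit Types (f g : 'rV[R]_n.+1 -> Cl) (al : nat -> Cl).

Definition fock_expansion f al : Prop :=
  cvgn (series (fun k => k`!%:R * `|al k| ^+ 2 : R)) /\
  forall x, series (fun k => appell k x * al k) @ \oo --> f x.

Definition fock : set ('rV[R]_n.+1 -> Cl) :=
  [set f | exists al, fock_expansion f al].

(* The coefficients are determined by f, because appell k x = (t ^+ k)%:A at
   the real points x = (t, 0, ..., 0) (for n > 0). *)
Definition fock_coef f : nat -> Cl :=
  xget (fun=> 0) [set al | fock_expansion f al].

Definition fock_dot f g : Cl :=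
  limn (series (fun k =>
    k`!%:R *: (cconj (fock_coef f k) * fock_coef g k))).

Definition fock_norm f : R := Num.sqrt (cre (fock_dot f f)).

Definition reproducing_kernel (K : 'rV[R]_n.+1 -> 'rV[R]_n.+1 -> Cl) : Prop :=
  forall y, fock (K ^~ y) /\
    forall f, fock f -> fock_dot (K ^~ y) f = f y.

Definition fock_kernel_term (x y : 'rV[R]_n.+1) (k : nat) : Cl :=
  k`!%:R^-1 *: (appell k x * cconj (appell k y)).

Definition fock_kernel (x y : 'rV[R]_n.+1) : Cl :=
  limn (series (fock_kernel_term x y)).

End Fock.

(* Main.v *)
(* If [x] is a paravector then [conj x * x] is the scalar [|x| ^ 2], so left
   multiplication by [x] scales the norm by exactly [|x|]. Since the
   coefficients T_s^k(n) are nonnegative and sum to 1 (Chu-Vandermonde), this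
   gives [|P_k(x) a| <= |x| ^ k |a|], and Cauchy-Schwarz yields the pointwise
   bound even without the factor [2 ^ (n / 2)]. On the real axis
   [P_k(t) = t ^ k], so expansion coefficients are unique by the identity
   theorem for power series. The coefficients of [K(., y)] are then
   [conj (P_k(y)) / k!], and testing a reproducing kernel on [f = P_k] shows that
   they are forced. *)
Require Import Defs.
From HB Require Import structures.
From mathcomp Require Import all_boot all_order all_algebra.
From mathcomp Require Import ring.
From mathcomp Require Import all_classical all_reals all_analysis.
Set Implicit Arguments.
Unset Strict Implicit.
Unset Printing Implicit Defensive.
Import Order.TTheory GRing.Theory Num.Theory.
Import numFieldNormedType.Exports.
Local Open Scope classical_set_scope.
Local Open Scope ring_scope.

(** * Rising factorials and the coefficients [appell_coef] *)

Section Pochhammer.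

Lemma pochhammerS (R : pzSemiRingType) (a : R) k :
  pochhammer a k.+1 = pochhammer a k * (a + k%:R).
Proof. exact: big_ord_recr. Qed.

(** Chu-Vandermonde by induction on [k]: the new factor [a + b + k] splits as
    [(a + (k - s)) + (b + s)], each half lengthens one rising factorial, and Pascal's rule regroups
    the two sums. *)
Lemma pochhammer_Vandermonde (R : comPzRingType) (a b : R) k :
  \sum_(s < k.+1) 'C(k, s)%:R * (pochhammer a (k - s) * pochhammer b s) =
  pochhammer (a + b) k.
Proof.
elim: k => [|k IHk]; first by rewrite big_ord1 /pochhammer !big_ord0 !mulr1.
rewrite pochhammerS -IHk big_distrl /=.
transitivity
  (\sum_(s < k.+1) 'C(k, s)%:R * (pochhammer a (k.+1 - s) * pochhammer b s) +
   \sum_(s < k.+1) 'C(k, s)%:R * (pochhammer a (k - s) * pochhammer b s.+1)).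
  rewrite big_ord_recl /= bin0.
  under eq_bigr => s _ do rewrite /bump /= add1n subSS binS natrD mulrDl.
  rewrite big_split /= addrA; congr (_ + _).
  (* The range may be extended to [s = k.+1], because ['C(k, k.+1)] vanishes. *)
  rewrite [LHS](_ : _ = \sum_(s < k.+2)
    'C(k, s)%:R * (pochhammer a (k.+1 - s) * pochhammer b s)); last first.
    by rewrite [RHS]big_ord_recl /= bin0.
  by rewrite big_ord_recr /= bin_small // mul0r addr0.
rewrite -big_split /=; apply: eq_bigr => s _.
have sk : (s <= k)%N by rewrite -ltnS.
rewrite (subSn sk) !pochhammerS.
have -> : a + b + k%:R = (a + (k - s)%:R) + (b + s%:R) :> R.
  by rewrite addrACA -natrD subnK.
by ring.
Qed.

Lemma pochhammer_ge0 (R : realType) (a : R) k : 0 <= a -> 0 <= pochhammer a k.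
Proof. by move=> a0; apply: prodr_ge0 => i _; rewrite addr_ge0. Qed.

Lemma pochhammer_gt0 (R : realType) (a : R) k : 0 < a -> 0 < pochhammer a k.
Proof. by move=> a0; apply: prodr_gt0 => i _; rewrite ltr_pwDl. Qed.

Lemma appell_coef_ge0 (R : realType) n k s :
  (0 < n)%N -> 0 <= appell_coef R n k s.
Proof.
move=> n0; rewrite /appell_coef divr_ge0 ?pochhammer_ge0 ?ler0n // mulr_ge0 //.
by rewrite mulr_ge0 ?pochhammer_ge0 ?divr_ge0 // subr_ge0 ler1n.
Qed.

Lemma sum_appell_coef (R : realType) n k :
  (0 < n)%N -> \sum_(s < k.+1) appell_coef R n k s = 1.
Proof.
move=> n0; rewrite -big_distrl /= pochhammer_Vandermonde.
have -> : (n%:R + 1) / 2 + (n%:R - 1) / 2 = n%:R :> R.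
  by rewrite mulrDl mulrBl addrACA subrr addr0 -splitr.
by rewrite divff // gt_eqF // pochhammer_gt0 // ltr0n.
Qed.

End Pochhammer.

(** * Norm, convergence and isometric multiplication in the Clifford algebra *)

Section CliffordNorm.
Context {R : realType} {n : nat}.
Local Notation Cl := (clifford R n).
Implicit Types (a b p : Cl) (A : {set 'I_n}).

Lemma cconjK : involutive (@cconj R n).
Proof. by move=> a; apply/ffunP => A; rewrite !ffunE mulrA csgn_sqr mul1r. Qed.

Lemma sqr_clifford_norm a : `|a| ^+ 2 = cre (cconj a * a).
Proof.
rewrite clifford_normE cre_conjM sqr_sqrtr //.
by apply: sumr_ge0 => A _; apply: sqr_ge0.
Qed.

Lemma clifford_norm_conj a : `|cconj a| = `|a|.
Proof.
rewrite !clifford_normE; congr (Num.sqrt _); apply: eq_bigr => A _.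
by rewrite ffunE exprMn expr2 csgn_sqr mul1r.
Qed.

Lemma clifford_norm1 : `|1 : Cl| = 1.
Proof.
by apply/eqP; rewrite -sqrp_eq1 // sqr_clifford_norm cconj1 mul1r /cre ffunE eqxx.
Qed.

Lemma ler_clifford_coord a A : `|a A| <= `|a|.
Proof.
rewrite clifford_normE -sqrtr_sqr ler_sqrt; last first.
  by apply: sumr_ge0 => B _; apply: sqr_ge0.
by rewrite (bigD1 A) //= lerDl; apply: sumr_ge0 => B _; apply: sqr_ge0.
Qed.

Lemma cvg_clifford_coord (u : nat -> Cl) (l : Cl) A :
  u @ \oo --> l -> (fun k => u k A) @ \oo --> l A.
Proof.
move=> /cvgrPdist_le ul; apply/cvgrPdist_le => e e0.
near=> k; apply: le_trans (near (ul e e0) k _); last by [].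
have -> : l A - u k A = (l - u k) A by rewrite clifford_addE; congr (_ + _); rewrite ffunE.
exact: ler_clifford_coord.
Unshelve. all: by end_near. Qed.

Lemma cvg_clifford (u : nat -> Cl) (l : Cl) :
  (forall A, (fun k => u k A) @ \oo --> l A) -> u @ \oo --> l.
Proof.
move=> ul; rewrite (clifford_sum_cbasis l).
rewrite (_ : u = fun k => \sum_A u k A *: cbasis A); last first.
  by apply/funext => k; apply: clifford_sum_cbasis.
apply: cvg_big => [|A _]; first exact: add_continuous.
exact: cvgZr_tmp (ul A).
Qed.

Lemma clifford_seriesE (u : nat -> Cl) A k :
  series u k A = series (fun i => u i A) k.
Proof. by rewrite /series /= clifford_sumE. Qed.

(** Comparison test: every coordinate series converges absolutely in [R], and the coordinate limits
    assemble into the limit in the algebra. *)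
Lemma clifford_abs_cvg (u : nat -> Cl) (v : nat -> R) :
  (forall k, `|u k| <= v k) -> cvgn (series v) -> cvgn (series u).
Proof.
move=> uv cv.
have cu A : cvgn (series (fun k => u k A)).
  apply: normed_cvg; apply: series_le_cvg cv => k //=.
  - exact: le_trans (uv k).
  - exact: le_trans (ler_clifford_coord _ _) (uv k).
apply/cvg_ex; exists [ffun A => limn (series (fun k => u k A))].
apply: cvg_clifford => A; rewrite ffunE.
by under eq_fun => k do rewrite clifford_seriesE; apply: cu.
Qed.

(** The square of [|p a|] is the scalar part of [conj a (conj p p) a], where the middle factor is a
    scalar and can be pulled out. For general [p] the norm is not multiplicative. *)
Lemma clifford_norm_mul p a (r : R) :
  0 <= r -> cconj p * p = (r ^+ 2)%:A -> `|p * a| = r * `|a|.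
Proof.
move=> r0 pE; apply/eqP; rewrite -(@eqrXn2 _ 2) // ?mulr_ge0 // exprMn.
rewrite !sqr_clifford_norm cconjM -mulrA [in cconj p * _]mulrA pE mulr_algl.
by rewrite -scalerAr /cre clifford_scaleE.
Qed.

Lemma clifford_norm_mulX p a (r : R) k :
  0 <= r -> cconj p * p = (r ^+ 2)%:A -> `|p ^+ k * a| = r ^+ k * `|a|.
Proof.
move=> r0 pE; elim: k => [|k IHk]; first by rewrite !expr0 !mul1r.
by rewrite !exprS -mulrA (clifford_norm_mul _ r0 pE) IHk mulrA.
Qed.

End CliffordNorm.

(** * Growth of the Appell polynomials and their values on the real axis *)

Section AppellBound.
Context {R : realType} {n : nat}.
Local Notation Cl := (clifford R n).
Implicit Types (x : 'rV[R]_n.+1) (a : Cl).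

Let vecpart x : Cl := \sum_(l < n) x 0 (lift ord0 l) *: cgen l.

Lemma vecpart_sqr x :
  vecpart x * vecpart x = (- \sum_(l < n) x 0 (lift ord0 l) ^+ 2)%:A.
Proof.
pose y l := x 0 (lift ord0 l).
(* Symmetrizing the double sum kills the off-diagonal terms. *)
pose S : Cl := \sum_(l < n) \sum_(m < n) (y l * y m) *: (cgen l * cgen m).
have uuS : vecpart x * vecpart x = S.
  rewrite /S mulr_suml; apply: eq_bigr => l _; rewrite mulr_sumr.
  by apply: eq_bigr => m _; rewrite -scalerAl -scalerAr scalerA.
have SS : S + S = (- \sum_(l < n) y l ^+ 2)%:A *+ 2.
  rewrite {2}/S exchange_big -big_split /= -sumrN scaler_suml -sumrMnl.
  apply: eq_bigr => l _; rewrite -big_split /= (bigD1 l) //= big1 ?addr0.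
    by rewrite cgen_sqr scalerN -scaleNr -expr2 mulr2n.
  move=> m ml; rewrite (mulrC (y m)) -scalerDr cgen_anticomm ?scaler0 //.
  by rewrite eq_sym.
rewrite uuS; apply: (scalerI (a := 2 : R)); first by rewrite pnatr_eq0.
by rewrite !scaler_nat mulr2n SS.
Qed.

Lemma cconj_paravectorM x :
  cconj (paravector x) * paravector x = (`|paravector x| ^+ 2)%:A.
Proof.
have sq : cconj (paravector x) * paravector x =
    (x 0 0 ^+ 2 + \sum_(l < n) x 0 (lift ord0 l) ^+ 2)%:A.
  rewrite cconj_paravector /paravector -/(vecpart x) mulrBl !mulrDr vecpart_sqr.
  rewrite !mulr_algl !mulr_algr opprD addrA addrK scalerA -expr2.
  by rewrite scalerDl scaleNr opprK.
by rewrite sqr_clifford_norm sq /cre clifford_scaleE ffunE eqxx mulr1.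
Qed.

(** This order of the factors is what makes multiplication by [conj x], and not only by [x], scale
    norms by [|x|]. *)
Lemma paravector_cconjM x :
  paravector x * cconj (paravector x) = (`|paravector x| ^+ 2)%:A.
Proof.
rewrite -cconj_paravectorM cconj_paravector /paravector -/(vecpart x).
by rewrite mulrBr mulrBl !mulrDl !mulrDr !mulr_algl !mulr_algr.
Qed.

Lemma norm_appell_mul k x a :
  (0 < n)%N -> `|appell k x * a| <= `|paravector x| ^+ k * `|a|.
Proof.
move=> n0; rewrite mulr_suml; apply: le_trans (ler_norm_sum _ _ _) _.
(* Writing 1 as the sum of the coefficients allows a termwise comparison; each monomial scales the
   norm of [a] by exactly [|x| ^ k]. *)
rewrite -[leRHS]mul1r -(sum_appell_coef R k n0) big_distrl /=.
apply: ler_sum => s _; have sk : (s <= k)%N by rewrite -ltnS.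
rewrite -scalerAl normrZ ger0_norm ?appell_coef_ge0 // -[_ * a]mulrA.
rewrite (clifford_norm_mulX _ _ _ (cconj_paravectorM x)) //.
rewrite (@clifford_norm_mulX _ _ _ _ `|paravector x|) //.
  by rewrite mulrA -exprD subnK.
by rewrite cconjK paravector_cconjM.
Qed.

Lemma norm_appell k x : (0 < n)%N -> `|appell k x| <= `|paravector x| ^+ k.
Proof.
move=> n0; rewrite -[appell k x]mulr1; apply: le_trans (norm_appell_mul _ _ _ n0) _.
by rewrite clifford_norm1 mulr1.
Qed.

Definition real_point (t : R) : 'rV[R]_n.+1 := \row_i (t *+ (i == 0)).

Lemma appell_real_point k t : (0 < n)%N -> appell k (real_point t) = (t ^+ k)%:A.
Proof.
move=> n0; have up0 : vecpart (real_point t) = 0.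
  by apply: big1 => l _; rewrite mxE scale0r.
have pE : paravector (real_point t) = t%:A.
  by rewrite /paravector -/(vecpart _) up0 addr0 mxE.
have cpE : cconj (paravector (real_point t)) = t%:A.
  by rewrite cconj_paravector -/(vecpart _) up0 subr0 mxE.
rewrite /appell cpE pE -[RHS]scale1r -(sum_appell_coef R k n0) scaler_suml.
apply: eq_bigr => s _; have sk : (s <= k)%N by rewrite -ltnS.
by rewrite -exprD subnK // exprZn expr1n.
Qed.

End AppellBound.

(** * Identity theorem for power series with vector coefficients *)

Section PowerSeries.
Context {R : realType} {V : normedModType R}.
Implicit Types c : nat -> V.

(** Convergence at [t = 1] bounds the coefficients by some [C], so for small [t] the partial sums
    differ from [c 0] by at most [t C / (1 - t)], which is arbitrarily small. *)
Lemma power_series_coef0 c :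
  (forall t : R, 0 < t -> series (fun k => t ^+ k *: c k) @ \oo --> (0 : V)) ->
  c 0%N = 0.
Proof.
move=> c_cvg.
have [C C0 cC] : exists2 C : R, 0 < C & forall k, `|c k| <= C.
  have /cvgP/cvg_series_cvg_0/cvgP/cvg_seq_bounded := c_cvg 1 ltr01.
  move=> [M [_ bM]]; exists (`|M| + 1) => [|k]; first by rewrite ltr_wpDl.
  have /(_ _ k I) /= := bM (`|M| + 1); rewrite expr1n scale1r; apply.
  by rewrite ltr_pwDr // ler_norm.
apply/eqP; rewrite -normr_eq0 eq_le normr_ge0 andbT; apply/ler_addgt0Pl => e e0.
(* The bound [t <= 1/2] gives [1 / (1 - t) <= 2], and then [t <= e / (2 C)] brings the tail
   [t C / (1 - t)] below [e]. *)
rewrite addr0; pose t := Num.min (2^-1) (e / (2 * C)).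
have t0 : 0 < t by rewrite lt_min invr_gt0 ltr0n divr_gt0 // mulr_gt0.
have t2 : t <= 2^-1 by rewrite ge_min lexx.
have tC : t * (2 * C) <= e by rewrite -ler_pdivlMr ?mulr_gt0 // ge_min lexx orbT.
have tail N : `|series (fun k => t ^+ k *: c k) N.+1 - c 0%N| <= e.
  rewrite seriesEnat /= big_nat_recl // expr0 scale1r addrC addKr.
  apply: le_trans (ler_norm_sum _ _ _) _; apply: le_trans tC.
  have h : t < 1 by rewrite (le_lt_trans t2) // invf_lt1 // ltr1n.
  apply: (@le_trans _ _ (series (geometric (t * C) t) N)).
    apply: ler_sum => i _; rewrite normrZ ger0_norm ?exprn_ge0 ?(ltW t0) //.
    rewrite /=; have -> : t * C * t ^+ i = t ^+ i.+1 * C by rewrite exprS mulrAC.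
    by rewrite ler_wpM2l // exprn_ge0 // (ltW t0).
  apply: le_trans (geometric_le_lim _ _ t0 _) _.
  - by rewrite mulr_ge0 // ltW.
  - by rewrite gtr0_norm.
  - rewrite mulrA mulrAC ler_pM2r // ler_pM2l // invf_ple ?posrE ?subr_gt0 //.
    by rewrite lerBrDr -lerBrDl (le_trans t2) // {2}[1]splitr mul1r addrK.
have := c_cvg t t0; rewrite -(cvg_shiftS _ (nbhs _)) => /= tcvg.
have ncvg : (fun N => `|series (fun k => t ^+ k *: c k) N.+1 - c 0%N|) @ \oo -->
    `|0 - c 0%N|.
  by apply: cvg_norm; apply: cvgB tcvg (cvg_cst _).
rewrite -normrN -sub0r -(cvg_lim _ ncvg) //.
by apply: limr_le; [exact: cvgP ncvg|near=> k; exact: tail].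
Unshelve. all: by end_near. Qed.

(** Once [c 0] is known to vanish, dividing the series by [t] gives the shifted sequence the same
    property; this is why only [t > 0] is assumed. *)
Lemma power_series_eq0 c :
  (forall t : R, 0 < t -> series (fun k => t ^+ k *: c k) @ \oo --> (0 : V)) ->
  forall k, c k = 0.
Proof.
move=> c_cvg k; elim: k c c_cvg => [|k IHk] c c_cvg.
  exact: power_series_coef0.
apply: (IHk (fun i => c i.+1)) => t t0.
have := c_cvg t t0; rewrite -(cvg_shiftS _ (nbhs _)) /=.
move=> /(cvgZl_tmp (k := t^-1)); rewrite scaler0; apply: cvg_trans.
apply: near_eq_cvg; near=> N.
rewrite /series /= big_nat_recl // (power_series_coef0 c_cvg) scaler0 add0r.
rewrite scaler_sumr; apply: eq_bigr => i _.
by rewrite scalerA exprS mulKf // gt_eqF.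
Unshelve. all: by end_near. Qed.

End PowerSeries.

(** * Auxiliary facts on finite sums and series *)

Lemma sum_Cauchy_Schwarz (R : realType) (I : Type) (r : seq I) (a b : I -> R) :
  (\sum_(i <- r) a i * b i) ^+ 2 <=
  (\sum_(i <- r) a i ^+ 2) * (\sum_(i <- r) b i ^+ 2).
Proof.
elim: r => [|i r]; first by rewrite !big_nil expr0n mulr0.
rewrite !big_cons; set S := \sum_(j <- r) a j * b j.
set A := \sum_(j <- r) _; set B := \sum_(j <- r) _ => SAB.
have A0 : 0 <= A by apply: sumr_ge0 => j _; apply: sqr_ge0.
have B0 : 0 <= B by apply: sumr_ge0 => j _; apply: sqr_ge0.
have x0 : 0 <= a i ^+ 2 * B by rewrite mulr_ge0 ?sqr_ge0.
have y0 : 0 <= b i ^+ 2 * A by rewrite mulr_ge0 ?sqr_ge0.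
have cross : 2 * (a i * b i * S) <= a i ^+ 2 * B + b i ^+ 2 * A.
  (* After squaring, the induction hypothesis replaces [S ^+ 2] by [A * B], and the remaining
     difference is a perfect square. *)
  apply: le_trans (ler_norm _) _; rewrite -ler_sqr ?nnegrE ?addr_ge0 //.
  rewrite real_normK ?num_real //.
  apply: (@le_trans _ _ (4 * (a i ^+ 2 * b i ^+ 2) * (A * B))).
    have -> : (2 * (a i * b i * S)) ^+ 2 = 4 * (a i ^+ 2 * b i ^+ 2) * S ^+ 2.
      by ring.
    by rewrite ler_wpM2l // mulr_ge0 // mulr_ge0 ?sqr_ge0.
  rewrite -subr_ge0.
  have -> : (a i ^+ 2 * B + b i ^+ 2 * A) ^+ 2 -
    4 * (a i ^+ 2 * b i ^+ 2) * (A * B) =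
    (a i ^+ 2 * B - b i ^+ 2 * A) ^+ 2 by ring.
  exact: sqr_ge0.
rewrite -subr_ge0.
have -> : (a i ^+ 2 + A) * (b i ^+ 2 + B) - (a i * b i + S) ^+ 2 =
  (a i ^+ 2 * B + b i ^+ 2 * A - 2 * (a i * b i * S)) + (A * B - S ^+ 2) by ring.
by rewrite addr_ge0 // subr_ge0.
Qed.

Lemma series_single_cvg (R : realType) (V : normedModType R) k (u : nat -> V) :
  (forall i, i != k -> u i = 0) -> series u @ \oo --> u k.
Proof.
move=> u0; apply: cvg_near_cst; near=> N.
have kN : (k < N)%N by near: N; exact: nbhs_infty_gt.
rewrite /series /= big_mkord (bigD1 (Ordinal kN)) //= big1 ?addr0 // => i ik.
by apply: u0; apply: contraNneq ik => ik; apply/eqP/val_inj.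
Unshelve. all: by end_near. Qed.

Lemma nneg_series_le_lim (R : realType) (u : nat -> R) N :
  (forall k, 0 <= u k) -> cvgn (series u) -> series u N <= limn (series u).
Proof.
move=> u0 cu; apply: nondecreasing_cvgn_le => //.
by apply: nondecreasing_series => k _ _; apply: u0.
Qed.

(** * Expansions, norm and pointwise bound in the Fock space *)

Section FockSpace.
Context {R : realType} {n : nat}.
Local Notation Cl := (clifford R n).
Hypothesis n_gt0 : (0 < n)%N.
Implicit Types (f g : 'rV[R]_n.+1 -> Cl) (al be : nat -> Cl).
Implicit Types x y : 'rV[R]_n.+1.

(* Each basis element acts isometrically by left multiplication, so the constant
   is the number of basis elements; any constant would do below. *)
Lemma norm_cliffordM_le (a b : Cl) :
  `|a * b| <= #|{set 'I_n}|%:R * (`|a| * `|b|).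
Proof.
rewrite {1}(clifford_sum_cbasis a) mulr_suml.
apply: le_trans (ler_norm_sum _ _ _) _.
rewrite mulr_natl -sumr_const; apply: ler_sum => A _.
rewrite -scalerAl normrZ (@clifford_norm_mul _ _ _ _ 1) //.
  by rewrite mul1r ler_wpM2r // ler_clifford_coord.
by rewrite cconj_basis -scalerAl cbasisM symdd scalerA csgn_sqr expr1n cbasis0.
Qed.

(** On the real axis both expansions become power series in [t] with the same sum, so their
    difference has zero coefficients. *)
Lemma fock_expansion_inj f al be :
  fock_expansion f al -> fock_expansion f be -> al = be.
Proof.
move=> [_ fal] [_ fbe]; apply/funext => k; apply/eqP; rewrite -subr_eq0; apply/eqP.
apply: (@power_series_eq0 R Cl (fun k => al k - be k)) => t _.
rewrite -(subrr (f (real_point t))).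
rewrite (_ : series _ = series (fun k => appell k (real_point t) * al k) -
  series (fun k => appell k (real_point t) * be k)); last first.
  rewrite -seriesN -seriesD; congr series; apply/funext => i.
  by rewrite !fctE appell_real_point // !mulr_algl scalerBr.
exact: cvgB.
Qed.

Lemma fock_coefE f al : fock_expansion f al -> fock_coef f = al.
Proof. by move=> fal; apply: xget_unique => // be /fock_expansion_inj; apply. Qed.

Lemma fock_dotE f g al be : fock_expansion f al -> fock_expansion g be ->
  fock_dot f g = limn (series (fun k => k`!%:R *: (cconj (al k) * be k))).
Proof. by move=> fal gbe; rewrite /fock_dot (fock_coefE fal) (fock_coefE gbe). Qed.

(** The series for [fock_dot f f] converges by comparison with the weighted square sum, so the
    scalar part, being a coordinate, can be taken termwise. *)
Lemma fock_normE f al : fock_expansion f al ->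
  fock_norm f = Num.sqrt (limn (series (fun k => k`!%:R * `|al k| ^+ 2 : R))).
Proof.
move=> fal; rewrite /fock_norm (fock_dotE fal fal); congr (Num.sqrt _).
pose u k : Cl := k`!%:R *: (cconj (al k) * al k).
have cu : cvgn (series u).
  apply: (clifford_abs_cvg _ (is_cvg_seriesZ (k := #|{set 'I_n}|%:R) fal.1)) => k.
  rewrite /u !fctE normrZ ger0_norm // [leRHS]mulrCA ler_wpM2l //.
  by apply: le_trans (norm_cliffordM_le _ _) _; rewrite clifford_norm_conj -expr2.
apply/esym/(cvg_lim (@norm_hausdorff _ _)).
have -> : series (fun k => k`!%:R * `|al k| ^+ 2) = fun N => cre (series u N).
  apply/funext => N; rewrite /cre clifford_seriesE; congr (series _ N).
  by apply/funext => k; rewrite clifford_scaleE -/(cre _) -sqr_clifford_norm.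
exact: cvg_clifford_coord cu.
Qed.

Lemma fock_norm_bound f x : fock f ->
  `|f x| <= expR (`|paravector x| ^+ 2 / 2) * fock_norm f.
Proof.
move=> [al fal]; rewrite (fock_normE fal); have [cal /(_ x) fx] := fal.
set r := `|paravector x|; set L := limn _.
have fact_gt0R k : 0 < k`!%:R :> R by rewrite ltr0n fact_gt0.
rewrite -(cvg_lim (@norm_hausdorff _ _) (cvg_norm fx)).
apply: limr_le; first exact: cvgP (cvg_norm fx).
(* The weights [sqrt k!] prepare Cauchy-Schwarz: the squares of the two factors sum to partial sums
   of [exp (r ^ 2)] and of the squared Fock norm. *)
near=> N; apply: (@le_trans _ _
    (\sum_(0 <= k < N) (r ^+ k / Num.sqrt k`!%:R) * (Num.sqrt k`!%:R * `|al k|))).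
  apply: le_trans (ler_norm_sum _ _ _) _; apply: ler_sum => k _.
  rewrite mulrA divfK; first exact: norm_appell_mul.
  by rewrite gt_eqF // sqrtr_gt0.
set E := expR _; have E0 : 0 <= E by apply: expR_ge0.
(* Both sides are put under one square root, reducing the claim to an inequality of squares with
   [E ^+ 2 = exp (r ^ 2)]. *)
rewrite -[E](ger0_norm E0) -sqrtr_sqr -sqrtrM ?sqr_ge0 //.
apply: le_trans (ler_norm _) _; rewrite -sqrtr_sqr; apply: ler_wsqrtr.
apply: le_trans (sum_Cauchy_Schwarz _ _ _) _.
have E2 : E ^+ 2 = expR (r ^+ 2) by rewrite -expRM_natl mulrC divfK ?pnatr_eq0.
apply: ler_pM; try by apply: sumr_ge0 => k _; apply: sqr_ge0.
- rewrite E2; apply: le_trans (nneg_series_le_lim N _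
    (is_cvg_series_exp_coeff (r ^+ 2))); last first.
    by move=> k; apply: exp_coeff_ge0; apply: sqr_ge0.
  apply: ler_sum => k _.
  by rewrite exp_coeffE /= exprMn exprVn sqr_sqrtr ?ler0n // mulrC -!exprM mulnC.
- apply: le_trans (nneg_series_le_lim N _ cal); last first.
    by move=> k; rewrite mulr_ge0 ?sqr_ge0.
  by apply: ler_sum => k _; rewrite exprMn sqr_sqrtr ?ler0n.
Unshelve. all: by end_near. Qed.

(** * The reproducing kernel: convergence, reproduction and uniqueness *)

Lemma fock_kernel_cvg x y : cvgn (series (fock_kernel_term x y)).
Proof.
(* The kernel terms are dominated by [(|x| |y|) ^ k / k!]. *)
have := is_cvg_series_exp_coeff (`|paravector x| * `|paravector y|).
apply: clifford_abs_cvg => k.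
rewrite normrZ ger0_norm ?invr_ge0 ?ler0n // exp_coeffE /= ler_wpM2l ?invr_ge0 //.
apply: le_trans (norm_appell_mul _ _ _ n_gt0) _.
by rewrite clifford_norm_conj exprMn ler_wpM2l ?exprn_ge0 // norm_appell.
Qed.

Lemma fock_kernel_termE x y k :
  fock_kernel_term x y k = appell k x * (k`!%:R^-1 *: cconj (appell k y)).
Proof. exact: scalerAr. Qed.

Lemma fock_expansion_kernel y : fock_expansion (@fock_kernel R n ^~ y)
  (fun k => k`!%:R^-1 *: cconj (appell k y)).
Proof.
split => [|x]; last first.
  under [X in series X]eq_fun => k do rewrite -fock_kernel_termE.
  exact: fock_kernel_cvg.
(* One factor [k!] cancels, leaving [|P_k(y)| ^ 2 / k!], at most the exponential term
   [|y| ^ (2 k) / k!]. *)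
apply: series_le_cvg (is_cvg_series_exp_coeff (`|paravector y| ^+ 2)) => k.
- by rewrite mulr_ge0 ?sqr_ge0.
- by apply: exp_coeff_ge0; apply: sqr_ge0.
rewrite normrZ ger0_norm ?invr_ge0 // exprMn expr2 !mulrA divff ?mul1r //.
rewrite exp_coeffE /= -mulrA -expr2 ler_wpM2l ?invr_ge0 // clifford_norm_conj -exprM mulnC exprM.
by rewrite ler_sqr ?nnegrE ?exprn_ge0 // norm_appell.
Qed.

(** These are the test functions that isolate a single coefficient in the uniqueness proof. *)
Lemma fock_expansion_appell k : fock_expansion (@appell R n k)
  (fun i => (i == k)%:R).
Proof.
split => [|x].
  apply: cvgP; apply: (@series_single_cvg R R^o k) => i /negPf ->.
  by rewrite normr0 expr0n mulr0.
have -> : appell k x = appell k x * (k == k)%:R by rewrite eqxx mulr1.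
apply: (@series_single_cvg _ _ k (fun i => appell i x * (i == k)%:R)) => i /negPf ->.
exact: mulr0.
Qed.

Lemma reproducing_fock_kernel : reproducing_kernel (@fock_kernel R n).
Proof.
move=> y; split; first by eexists; exact: fock_expansion_kernel.
move=> f [al fal]; rewrite (fock_dotE (fock_expansion_kernel y) fal).
apply: (cvg_lim (@norm_hausdorff _ _)).
(* Conjugation is involutive and [k!] cancels, so the inner product series is the expansion of [f]
   at [y]. *)
rewrite (_ : (fun k => _) = fun k => appell k y * al k); first exact: fal.2.
by apply/funext => k; rewrite cconjZ cconjK -scalerAl scalerA divff ?scale1r.
Qed.

Lemma reproducing_kernel_unique (K : 'rV[R]_n.+1 -> 'rV[R]_n.+1 -> Cl) :
  reproducing_kernel K -> forall x y, K x y = fock_kernel x y.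
Proof.
move=> Krep x y; have [[ga Kga] Ky] := Krep y.
have gaE k : ga k = k`!%:R^-1 *: cconj (appell k y).
  (* Pairing with [P_k] leaves [k! conj (ga k) = P_k(y)], which determines [ga k]. *)
  have := Ky _ (ex_intro _ _ (fock_expansion_appell k)).
  rewrite (fock_dotE Kga (fock_expansion_appell k)).
  have single i : i != k -> i`!%:R *: (cconj (ga i) * (i == k)%:R) = 0.
    by move=> /negPf ->; rewrite mulr0 scaler0.
  rewrite (cvg_lim (@norm_hausdorff _ _) (series_single_cvg single)).
  rewrite eqxx mulr1 => <-.
  by rewrite cconjZ cconjK scalerA mulVf ?scale1r.
have [_ /(_ x) Kx] := Kga; apply/esym/(cvg_lim (@norm_hausdorff _ _)).
rewrite (_ : fock_kernel_term x y = fun k => appell k x * ga k) //.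
by apply/funext => k; rewrite fock_kernel_termE gaE.
Qed.

End FockSpace.

Theorem theorem5p3 (R : realType) (n : nat) (hn : odd n) :
  (forall f : 'rV[R]_n.+1 -> clifford R n, fock f ->
    forall x : 'rV[R]_n.+1,
      `|f x| <= 2 `^ (n%:R / 2) * expR (`|paravector x| ^+ 2 / 2) * fock_norm f)
  /\
  (forall x y : 'rV[R]_n.+1, cvgn (series (fock_kernel_term x y))) /\
  reproducing_kernel (@fock_kernel R n) /\
  (forall K : 'rV[R]_n.+1 -> 'rV[R]_n.+1 -> clifford R n,
    reproducing_kernel K -> forall x y, K x y = fock_kernel x y).
Proof.
have n_gt0 : (0 < n)%N by exact: odd_gt0.
split=> [f ff x|].
  apply: le_trans (fock_norm_bound n_gt0 x ff) _; rewrite -mulrA.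
  (* The bound without the constant suffices, since [2 ^ (n / 2) >= 2 ^ 0 = 1]. *)
  rewrite ler_peMl ?mulr_ge0 ?expR_ge0 ?sqrtr_ge0 //.
  by rewrite -[leLHS](powRr0 (2 : R)) ler_powR ?ler1n // divr_ge0.
split; first exact: fock_kernel_cvg.
split; first exact: reproducing_fock_kernel.
exact: reproducing_kernel_unique.
Qed.
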